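(* Let $G$ be a finite group, let $*$ be a nonidentical involutory antiautomorphism of $G$ with $gg^*\in Z(G)$ for every $g\in G$, and let $g_0\in Z(G)$ with $g_0^*=g_0$. Let $\beta\in\{xy,\,x^*y,\,yx,\,yx^*\}$, $\gamma\in\{xy,\,yx\}$ and $\delta\in\{g_0xy,\,g_0xy^*,\,g_0x^*y,\,g_0x^*y^*,\,g_0yx,\,g_0yx^*,\,g_0y^*x,\,g_0y^*x^*\}$. Then the loop $L=Q(G,*,g_0,\beta,\gamma,\delta)$ is right alternative if and only if at least one of the following holds: (a) $L$ is right Bol or an RC-loop; (b) $(\beta,\gamma,\delta)$ is among $(xy,xy,g_0xy^* )$, $(xy,yx,g_0xy^* )$, $(x^*y,xy,g_0yx^* )$, $(yx,xy,g_0y^*x)$, $(yx,yx,g_0y^*x)$, $(yx^*,xy,g_0x^*y)$, $(yx^*,yx,g_0x^*y)$; (c) $(xx)^*=xx$ for every $x\in G$ and $(\beta,\gamma,\delta)=(yx^*,yx,g_0x^*y^* )$.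
   Context: $Z(G)$ is the center of $G$. An involutory antiautomorphism $*$ of $G$ satisfies $(g^* )^*=g$ and $(gh)^*=h^*g^*$; nonidentical means $g^*\neq g$ for some $g\in G$. A word such as $yx^*$ or $g_0y^*x$ denotes the function $G\times G\to G$ sending $(x,y)$ to the value of the word. Words are regarded as functions: two words are identified when they define the same function on $G\times G$ (for instance $xy$ and $yx$ when $G$ is commutative), and equality of triples $(\beta,\gamma,\delta)$ means equality of the three functions. Let $Gu=\{gu : g\in G\}$ be a disjoint copy of $G$. The loop $Q(G,*,g_0,\beta,\gamma,\delta)$ is the set $G\cup Gu$ with the multiplication, for $x,y\in G$, $$x\circ y=xy,\quad x\circ yu=\beta(x,y)u,\quad xu\circ y=\gamma(x,y)u,\quad xu\circ yu=\delta(x,y).$$ It is a loop with neutral element $1\in G$. A loop is right alternative if it satisfies $x(yy)=(xy)y$, right Bol if it satisfies $x((yz)y)=((xy)z)y$, and an RC-loop if it satisfies $x((yz)z)=(xy)(zz)$. *)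

(* Defs.v *)
From mathcomp Require Import all_boot all_fingroup all_solvable.

Set Implicit Arguments.
Unset Strict Implicit.
Unset Printing Implicit Defensive.

Local Open Scope group_scope.

Definition is_loop (T : Type) (op : T -> T -> T) (e : T) : Prop :=
  [/\ left_id e op, right_id e op,
      forall a, bijective (op a) & forall a, bijective (op^~ a)].

Definition right_alternative (T : Type) (op : T -> T -> T) : Prop :=
  forall x y, op x (op y y) = op (op x y) y.

Definition right_Bol (T : Type) (op : T -> T -> T) : Prop :=
  forall x y z, op x (op (op y z) y) = op (op (op x y) z) y.

Definition RC_loop (T : Type) (op : T -> T -> T) : Prop :=
  forall x y z, op x (op (op y z) z) = op (op x y) (op z z).

Definition antiautomorphism (G : finGroupType) (star : G -> G) : Prop :=
  bijective star /\ forall g h, star (g * h) = star h * star g.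

(* Finite functions have extensional equality, so two words giving the same
   function on G x G are equal (even if they differ syntactically). *)
Definition word (G : finGroupType) (w : G -> G -> G) : {ffun G * G -> G} :=
  [ffun p => w p.1 p.2].

Notation "[ 'word' x , y => E ]" := (word (fun x y => E))
  (at level 0, x name, y name, format "[ 'word'  x ,  y  =>  E ]").

Definition beta_words (G : finGroupType) (star : G -> G) :
    seq {ffun G * G -> G} :=
  [:: [word x, y => x * y]; [word x, y => star x * y];
      [word x, y => y * x]; [word x, y => y * star x] ].

Definition gamma_words (G : finGroupType) : seq {ffun G * G -> G} :=
  [:: [word x, y => x * y]; [word x, y => y * x] ].

Definition delta_words (G : finGroupType) (star : G -> G) (g0 : G) :
    seq {ffun G * G -> G} :=
  [:: [word x, y => g0 * x * y]; [word x, y => g0 * x * star y];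
      [word x, y => g0 * star x * y]; [word x, y => g0 * star x * star y];
      [word x, y => g0 * y * x]; [word x, y => g0 * y * star x];
      [word x, y => g0 * star y * x]; [word x, y => g0 * star y * star x] ].

(* The carrier of Q(G, *, g0, beta, gamma, delta) is the disjoint union G + G:
   inl x stands for x and inr x for xu.  The parameters * and g0 enter the
   product only through beta, gamma and delta. *)
Definition Qmul (G : finGroupType) (beta gamma delta : {ffun G * G -> G})
    (a b : G + G) : G + G :=
  match a, b with
  | inl x, inl y => inl (x * y)
  | inl x, inr y => inr (beta (x, y))
  | inr x, inl y => inr (gamma (x, y))
  | inr x, inr y => inl (delta (x, y))
  end.

Lemma Qmul_is_loop (G : finGroupType) (star : G -> G) (g0 : G)
    (beta gamma delta : {ffun G * G -> G}) :
  antiautomorphism star ->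
  beta \in beta_words star -> gamma \in gamma_words G ->
  delta \in delta_words star g0 ->
  is_loop (Qmul beta gamma delta) (inl 1).
Proof.
move=> [star_bij starM] Hb Hc Hd.
have star_inj : injective star := bij_inj star_bij.
have star1 : star 1 = 1.
  by apply: (mulgI (star 1)); rewrite -starM !mulg1.
have bI x : injective (fun y => beta (x, y)).
  move: Hb; rewrite !inE => /or4P[] /eqP -> y z; rewrite !ffunE /=;
  by [move/mulgI | move/mulIg].
have bI' y : injective (fun x => beta (x, y)).
  by move: Hb; rewrite !inE => /or4P[] /eqP -> x z; rewrite !ffunE /=;
  first [move/mulgI | move/mulIg] => // /star_inj.
have cI x : injective (fun y => gamma (x, y)).
  by move: Hc; rewrite !inE => /orP[] /eqP -> y z; rewrite !ffunE /=;
  first [move/mulgI | move/mulIg].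
have cI' y : injective (fun x => gamma (x, y)).
  by move: Hc; rewrite !inE => /orP[] /eqP -> x z; rewrite !ffunE /=;
  first [move/mulgI | move/mulIg].
have dI x : injective (fun y => delta (x, y)).
  by move: Hd; rewrite !inE; do ![case/orP]; move=> /eqP -> y z;
  rewrite !ffunE /= -?mulgA => /mulgI; first [move/mulgI | move/mulIg];
  move=> // /star_inj.
have dI' y : injective (fun x => delta (x, y)).
  by move: Hd; rewrite !inE; do ![case/orP]; move=> /eqP -> x z;
  rewrite !ffunE /= -?mulgA => /mulgI; first [move/mulgI | move/mulIg];
  move=> // /star_inj.
split=> [[y|y]|[x|x]|a|a] /=.
- by rewrite mul1g.
- congr inr; move: Hb; rewrite !inE => /or4P[] /eqP ->;
  by rewrite ffunE /= ?star1 ?mul1g ?mulg1.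
- by rewrite mulg1.
- congr inr; move: Hc; rewrite !inE => /orP[] /eqP ->;
  by rewrite ffunE /= ?mul1g ?mulg1.
- apply: injF_bij; case: a => x [y|y] [z|z] //= [].
  + by move/mulgI->.
  + by move/bI->.
  + by move/cI->.
  + by move/dI->.
- apply: injF_bij; case: a => x [y|y] [z|z] //= [].
  + by move/mulIg->.
  + by move/cI'->.
  + by move/bI'->.
  + by move/dI'->.
Qed.

(* Main.v *)
(* Write x' for star x.  Right alternativity of the loop only has content when
   the squared element lies in Gu, where it amounts to two identities of words
   in G.  Since the norm x x' is central, these identities either hold outright,
   or force some of the following: G is commutative, squares of G are central,
   squares of G are fixed by star.  When squares of G are central, and fixed by
   star if delta involves y', every square of the loop lies in its right
   nucleus, so the loop is RC.  Besides the group (xy, xy, g0 x y), the only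
   other loop outside the listed triples is Chein's Moufang loop
   (x'y, yx, g0 y x'), which is right Bol. *)

Require Import Defs.
From mathcomp Require Import all_boot all_fingroup all_solvable.

Local Open Scope group_scope.

(** * Words as functions, and links between the loop laws *)

Lemma eq_word (G : finGroupType) (v w : G -> G -> G) :
  v =2 w -> word v = word w.
Proof. by move=> vw; apply/ffunP=> p; rewrite !ffunE. Qed.

Lemma gamma_word_central (G : finGroupType) (gamma : {ffun G * G -> G}) y c :
  gamma \in gamma_words G -> (forall x, commute c x) -> gamma (y, c) = y * c.
Proof.
by move=> gamma_word cC; move: gamma_word; rewrite !inE => /orP[] /eqP ->;
  rewrite ffunE /= ?cC.
Qed.

(** The second hypothesis says that all squares lie in the right nucleus. *)
Lemma right_alternative_RC_loop (T : Type) (op : T -> T -> T) :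
  right_alternative op ->
  (forall x y z, op x (op y (op z z)) = op (op x y) (op z z)) -> RC_loop op.
Proof. by move=> RA nucl x y z; rewrite -RA nucl. Qed.

Lemma RC_loop_right_alternative (T : Type) (op : T -> T -> T) (e : T) :
  left_id e op -> RC_loop op -> right_alternative op.
Proof. by move=> ide RC x y; have := RC e x y; rewrite !ide. Qed.

Lemma right_Bol_right_alternative (T : Type) (op : T -> T -> T) (e : T) :
  right_id e op -> right_Bol op -> right_alternative op.
Proof. by move=> ide Bol x y; have := Bol x y e; rewrite !ide. Qed.

Section QLoops.

Variables (G : finGroupType) (star : G -> G) (g0 : G).
Hypotheses (star_anti : antiautomorphism star) (star_inv : involutive star).
Hypothesis star_central : forall g, g * star g \in 'Z([set: G]).
Hypotheses (g0_central : g0 \in 'Z([set: G])) (g0_fixed : star g0 = g0).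

Implicit Types (x y z c : G) (beta gamma delta : {ffun G * G -> G}).

(** * Calculus of [star], its central norms and [g0] *)

Lemma starM x y : star (x * y) = star y * star x.
Proof. by case: star_anti. Qed.

Lemma star1 : star 1 = 1.
Proof. by apply: (mulgI (star 1)); rewrite -starM !mulg1. Qed.

Lemma center_commute c : c \in 'Z([set: G]) -> forall x, commute c x.
Proof. by case/centerP=> _ cC x; apply: cC; rewrite inE. Qed.

Lemma g0C x : g0 * x = x * g0.
Proof. exact: center_commute. Qed.

Lemma normC x y : x * star x * y = y * (x * star x).
Proof. exact: center_commute. Qed.

(** Both sides agree after multiplication by x on the left, because x x' is central. *)
Lemma starC x : star x * x = x * star x.
Proof. by apply: (mulgI x); rewrite mulgA normC. Qed.

Lemma mulg_g0 x y : x * (g0 * y) = g0 * (x * y).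
Proof. by rewrite !mulgA g0C. Qed.

Lemma star_g0M x : star (g0 * x) = g0 * star x.
Proof. by rewrite starM g0_fixed -g0C. Qed.

(** When the squared element lies in G, the law is associativity of G, for either choice of [gamma].
    The two identities are the cases x in G and x in Gu with the squared element in Gu. *)
Lemma right_alternative_QmulP beta gamma delta :
  gamma \in gamma_words G ->
  right_alternative (Qmul beta gamma delta) <->
  (forall x y, delta (beta (x, y), y) = x * delta (y, y)) /\
  (forall x y, gamma (x, delta (y, y)) = beta (delta (x, y), y)).
Proof.
move=> gamma_word; split=> [RA | [RAG RAu]].
  split=> x y; first by case: (RA (inl x) (inr y)).
  by case: (RA (inr x) (inr y)).
case=> [] x [] y //=; rewrite ?mulgA ?RAG ?RAu //.
by congr inr; move: gamma_word; rewrite !inE => /orP[] /eqP ->;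
  rewrite !ffunE /= mulgA.
Qed.

(** S is a set of central elements that contains every square of the loop and whose members can be
    pulled out of the second argument of [delta]. It is left abstract because a [delta] that stars y
    also needs them to be fixed by [star]. *)
Lemma RC_loop_Qmul (S : G -> Prop) beta gamma delta :
  beta \in beta_words star -> gamma \in gamma_words G ->
  right_alternative (Qmul beta gamma delta) ->
  (forall c, S c -> forall x, commute c x) ->
  (forall x, S (x * x)) -> (forall x, S (delta (x, x))) ->
  (forall c, S c -> forall x y, delta (x, y * c) = delta (x, y) * c) ->
  RC_loop (Qmul beta gamma delta).
Proof.
move=> beta_word gamma_word RA SC Ssq Sdelta deltaM.
apply: right_alternative_RC_loop => // x y z.
(* Squares from both halves of the loop land in G, inside S. *)
have [c Sc ->] : exists2 c, S c & Qmul beta gamma delta z z = inl c.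
  by case: z => z; [exists (z * z) | exists (delta (z, z))].
have cC := SC _ Sc.
have gammac t : gamma (t, c) = t * c by apply: gamma_word_central.
case: x y => [] x [] y /=; rewrite ?gammac ?mulgA ?deltaM //; congr inr.
  by move: beta_word; rewrite !inE => /or4P[] /eqP ->; rewrite !ffunE /=;
    rewrite ?mulgA // -!mulgA cC.
by move: gamma_word; rewrite !inE => /orP[] /eqP ->; rewrite !ffunE /=;
  rewrite ?mulgA // -!mulgA cC.
Qed.

(* Setting y = 1 in the hypothesis says that beta stars x exactly when delta
   does.  In half of the remaining cases the hypothesis forces G to be
   commutative, and commuting the letters leads back to the list. *)
Lemma beta_delta_words beta delta :
  (exists g, star g <> g) ->
  beta \in beta_words star -> delta \in delta_words star g0 ->
  (forall x y, delta (beta (x, y), y) = x * delta (y, y)) ->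
  (beta, delta) \in
    [:: ([word x, y => x * y], [word x, y => g0 * x * y]);
        ([word x, y => x * y], [word x, y => g0 * x * star y]);
        ([word x, y => star x * y], [word x, y => g0 * y * star x]);
        ([word x, y => star x * y], [word x, y => g0 * star y * star x]);
        ([word x, y => y * x], [word x, y => g0 * y * x]);
        ([word x, y => y * x], [word x, y => g0 * star y * x]);
        ([word x, y => y * star x], [word x, y => g0 * star x * y]);
        ([word x, y => y * star x], [word x, y => g0 * star x * star y]) ].
Proof.
move=> [a star_a] beta_word delta_word RAG.
have starNid : ~ (forall x, star x = x) by move/(_ a).
have [comm | ncomm] := boolP [forall x : G, forall y : G, x * y == y * x].
  (* Commuting letters reduces [beta] to two words and [delta] to four, in the goal as well. A pair
     outside the list then stars x in only one of its two words, and y = 1 gives x' = x. *)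
  have {}comm x y : x * y = y * x by apply/eqP/(forallP (forallP comm x)).
  have e1 : [word x, y => y * x] = [word x, y => x * y] :> {ffun G * G -> G}.
    exact: eq_word.
  have e2 : [word x, y => y * star x] = [word x, y => star x * y].
    by apply: eq_word => x y.
  have e3 : [word x, y => g0 * y * x] = [word x, y => g0 * x * y].
    by apply: eq_word => x y; rewrite -!mulgA (comm y).
  have e4 : [word x, y => g0 * y * star x] = [word x, y => g0 * star x * y].
    by apply: eq_word => x y; rewrite -!mulgA (comm y).
  have e5 : [word x, y => g0 * star y * x] = [word x, y => g0 * x * star y].
    by apply: eq_word => x y; rewrite -!mulgA (comm x).
  have e6 : [word x, y => g0 * star y * star x] =
            [word x, y => g0 * star x * star y].
    by apply: eq_word => x y; rewrite -!mulgA (comm (star x)).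
  move: beta_word delta_word; rewrite /beta_words /delta_words.
  rewrite !(e1, e2, e3, e4, e5, e6) => beta_word delta_word.
  move: beta_word delta_word RAG.
  rewrite !inE; do ![case/orP]; move=> /eqP ->; do ![case/orP];
    move=> /eqP -> RAG; rewrite ?eqxx ?orbT //; case: starNid => x;
    have := RAG x 1; rewrite !ffunE /= ?(star1, mulg1, mul1g, star_inv);
    by rewrite -?g0C => /mulgI.
have {}ncomm : ~ (forall x y, y * x = x * y).
  move=> comm; case/negP: ncomm; apply/forallP=> x; apply/forallP=> y.
  by rewrite comm.
have ncommS : ~ (forall x y, star y * x = x * star y).
  by move=> comm; apply: ncomm => x y; rewrite -(star_inv y).
move: beta_word delta_word RAG.
rewrite !inE; do ![case/orP]; move=> /eqP ->; do ![case/orP];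
  move=> /eqP -> RAG; rewrite ?eqxx ?orbT //; exfalso.
all: try by apply: starNid => x;
    have := RAG x 1; rewrite !ffunE /= ?(star1, mulg1, mul1g, star_inv);
    rewrite -?g0C => /mulgI.
(* Eight pairs remain. Cancelling [g0] and the last letter leaves either y x = x y or y' x = x y';
   the latter also gives commutativity because [star] is onto. *)
all: try by apply: ncomm => x y; have := RAG x y; rewrite !ffunE /=;
    rewrite ?(starM, star_inv) -!mulgA mulg_g0 => /mulgI; rewrite !mulgA;
    move/mulIg.
all: try by apply: ncommS => x y; have := RAG x y; rewrite !ffunE /=;
    rewrite ?(starM, star_inv) -!mulgA mulg_g0 => /mulgI; rewrite !mulgA;
    move/mulIg.
Qed.

(** * Loops shown to be RC or right Bol *)

Lemma commute_g0M c : (forall x, commute c x) -> forall x, commute (g0 * c) x.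
Proof. by move=> cC x; rewrite /commute -mulgA cC mulg_g0. Qed.

Lemma RC_loop_central_squares beta gamma delta :
  beta \in beta_words star -> gamma \in gamma_words G ->
  delta \in [:: [word x, y => g0 * x * y]; [word x, y => g0 * y * x]] ->
  right_alternative (Qmul beta gamma delta) ->
  (forall y x, commute (y * y) x) -> RC_loop (Qmul beta gamma delta).
Proof.
move=> beta_word gamma_word delta_word RA sqC.
apply: (@RC_loop_Qmul (fun c => forall x, commute c x)) => // [x|c cC x y].
  by move: delta_word; rewrite !inE => /orP[] /eqP -> z;
    rewrite ffunE /= -mulgA; apply: commute_g0M.
move: delta_word; rewrite !inE => /orP[] /eqP ->;
  by rewrite !ffunE /= -!mulgA // cC.
Qed.

Lemma RC_loop_fixed_central_squares beta gamma delta :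
  beta \in beta_words star -> gamma \in gamma_words G ->
  delta \in [:: [word x, y => g0 * star x * star y];
                [word x, y => g0 * star y * star x]] ->
  right_alternative (Qmul beta gamma delta) ->
  (forall y x, commute (y * y) x) -> (forall y, star y * star y = y * y) ->
  RC_loop (Qmul beta gamma delta).
Proof.
move=> beta_word gamma_word delta_word RA sqC sqS.
(* For c central and fixed, (y c)' = c y', so c leaves the starred argument unchanged. *)
apply: (@RC_loop_Qmul (fun c => (forall x, commute c x) /\ star c = c)) => //.
- by move=> c [].
- by move=> x; rewrite starM sqS.
- move=> x; have -> : delta (x, x) = g0 * (x * x).
    by move: delta_word; rewrite !inE => /orP[] /eqP ->;
      rewrite ffunE /= -mulgA sqS.
  by split; [apply: commute_g0M | rewrite star_g0M starM sqS].
- move=> c [cC cS] x y.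
  move: delta_word; rewrite !inE => /orP[] /eqP ->;
    by rewrite !ffunE /= starM cS -!mulgA cC // -!mulgA.
Qed.

(** What associativity and the rules for [star] leave open is settled by sliding a central norm past
    a letter. *)
Lemma right_Bol_Chein :
  right_Bol (Qmul [word x, y => star x * y] [word x, y => y * x]
                  [word x, y => g0 * y * star x]).
Proof.
have normCA x y z : y * (x * (star x * z)) = x * (star x * (y * z)).
  by rewrite (mulgA x) mulgA -normC -!mulgA.
case=> [] x [] y [] z; rewrite /= ?ffunE /= -?mulgA ?(starM, star_inv) //.
all: rewrite -?mulgA ?g0_fixed //; congr (_ _).
- by rewrite normCA.
- by rewrite mulg_g0 normCA.
- by rewrite starC -normC -!mulgA (normCA y z).
- by rewrite !mulg_g0 starC -normC -!mulgA (normCA y (star z)).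
Qed.

End QLoops.

Theorem theorem8p11 (G : finGroupType) (star : G -> G) (g0 : G)
    (beta gamma delta : {ffun G * G -> G})
    (star_anti : antiautomorphism star)
    (star_inv : involutive star)
    (star_nonid : exists g, star g <> g)
    (star_central : forall g, g * star g \in 'Z([set: G]))
    (g0_central : g0 \in 'Z([set: G]))
    (g0_fixed : star g0 = g0)
    (beta_word : beta \in beta_words star)
    (gamma_word : gamma \in gamma_words G)
    (delta_word : delta \in delta_words star g0) :
  let L := Qmul beta gamma delta in
  right_alternative L <->
  [\/ right_Bol L \/ RC_loop L,
      (beta, gamma, delta) \in
        [:: ([word x, y => x * y], [word x, y => x * y],
             [word x, y => g0 * x * star y]);
            ([word x, y => x * y], [word x, y => y * x],
             [word x, y => g0 * x * star y]);
            ([word x, y => star x * y], [word x, y => x * y],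
             [word x, y => g0 * y * star x]);
            ([word x, y => y * x], [word x, y => x * y],
             [word x, y => g0 * star y * x]);
            ([word x, y => y * x], [word x, y => y * x],
             [word x, y => g0 * star y * x]);
            ([word x, y => y * star x], [word x, y => x * y],
             [word x, y => g0 * star x * y]);
            ([word x, y => y * star x], [word x, y => y * x],
             [word x, y => g0 * star x * y]) ]
    | (forall x, star (x * x) = x * x) /\
      (beta, gamma, delta) =
        ([word x, y => y * star x], [word x, y => y * x],
         [word x, y => g0 * star x * star y]) ].
Proof.
cbv zeta.
have [id1L idL1 _ _] := Qmul_is_loop star_anti beta_word gamma_word delta_word.
have RAP := right_alternative_QmulP _ beta gamma delta gamma_word.
have xNC := normC _ _ star_central; have sC := starC _ _ star_central.
have sCA x z : star x * (x * z) = x * (star x * z) by rewrite !mulgA sC.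
have sM := starM _ _ star_anti; have g0M := mulg_g0 _ _ g0_central.
have xg0 x : x * g0 = g0 * x by rewrite (g0C _ _ g0_central).
have RCC := RC_loop_central_squares _ star _ g0_central.
have RCS := RC_loop_fixed_central_squares _ _ _ star_anti g0_central g0_fixed.
split=> [RA | [[Bol | RC] | triple | [sq_fixed [eb eg ed]]]].
{ have [RAG RAu] := RAP.1 RA.
  (* With the two choices of [gamma], eight pairs give sixteen triples. Seven are those of the
     second alternative; the bullets treat the other nine, four with [gamma] = xy and then five with
     [gamma] = yx. *)
  have := beta_delta_words _ _ _ star_anti star_inv g0_central _ _ star_nonid
            beta_word delta_word RAG.
  move: (gamma_word); rewrite 2!inE => /orP[] /eqP eg; rewrite !inE !xpair_eqE;
    do ![case/orP]; move=> /andP[/eqP eb /eqP ed]; subst beta gamma delta;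
    rewrite ?eqxx ?orbT /=; try by constructor 2.
  - constructor 1; right; apply: right_alternative_RC_loop => //.
    by case=> [] x [] y [] z; rewrite /= ?ffunE /= -!mulgA ?g0M.
  (* The second identity at x = 1 gives y' y' = y y; the first says that y' y' is central. *)
  - constructor 1; right; have sqS y : star y * star y = y * y.
      have := RAu 1 y; rewrite !ffunE /= ?(sM, star_inv) g0_fixed.
      by rewrite !mul1g xg0 -!mulgA => /mulgI.
    apply: RCS => //; rewrite ?inE ?eqxx ?orbT // => y x.
    have := RAG x y; rewrite !ffunE /= ?(sM, star_inv) -!mulgA g0M.
    by move/mulgI; rewrite mulgA sqS.
  - constructor 1; right.
    apply: RCC => //; rewrite ?inE ?eqxx ?orbT // => y x.
    by have := RAG x y; rewrite !ffunE /= -!mulgA g0M => /mulgI; rewrite mulgA.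
  (* Here the first identity holds outright, so both facts about squares come from the second. *)
  - constructor 1; right; have sqS y : star y * star y = y * y.
      have := RAu 1 y; rewrite !ffunE /= ?(sM, star_inv) g0_fixed.
      by rewrite !mul1g xg0 -!mulgA !g0M => /mulgI.
    apply: RCS => //; rewrite ?inE ?eqxx ?orbT // => y x.
    have := RAu x y; rewrite !ffunE /= ?(sM, star_inv) g0_fixed xg0.
    by rewrite -!mulgA !g0M => /mulgI; rewrite sqS (mulgA y).
  - constructor 1; right.
    apply: RCC => //; rewrite ?inE ?eqxx ?orbT // => y x.
    by have := RAu x y; rewrite !ffunE /= -!mulgA => /mulgI; rewrite mulgA.
  - by constructor 1; left; apply: right_Bol_Chein.
  - constructor 1; right; have sqS y : star y * star y = y * y.
      have := RAu 1 y; rewrite !ffunE /= ?(sM, star_inv) g0_fixed.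
      by rewrite mulg1 !mul1g xg0 -!mulgA => /mulgI.
    apply: RCS => //; rewrite ?inE ?eqxx ?orbT // => y x.
    have := RAG x y; rewrite !ffunE /= ?(sM, star_inv) -!mulgA g0M.
    by move/mulgI; rewrite mulgA sqS.
  - constructor 1; right.
    apply: RCC => //; rewrite ?inE ?eqxx ?orbT // => y x.
    by have := RAG x y; rewrite !ffunE /= -!mulgA g0M => /mulgI; rewrite mulgA.
  (* The second identity reads y' y' x = y y x up to [g0]: it fixes squares without making them
     central. *)
  - constructor 3; split=> // x; have := RAu 1 x; rewrite !ffunE /=.
    by rewrite ?(sM, star_inv) g0_fixed mulg1 mul1g xg0 -!mulgA !g0M => /mulgI.
}
- exact: right_Bol_right_alternative _ _ _ idL1 Bol.
- exact: RC_loop_right_alternative _ _ _ id1L RC.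
(* With [g0] in front, the two sides of each identity differ at most in the place and order of the
   central norm y y' = y' y. *)
- apply/RAP; move: triple; rewrite !inE !xpair_eqE;
    do ![case/orP]; move=> /andP[/andP[/eqP -> /eqP ->] /eqP ->];
    split=> x y; rewrite !ffunE /= ?(sM, star_inv) ?g0_fixed;
    by rewrite ?xg0 -!mulgA ?g0M ?sC // -?xNC -?mulgA ?sCA.
- have sqS y : star y * star y = y * y by rewrite -sM sq_fixed.
  (* The first identity holds outright; only the second uses that squares are fixed. *)
  apply/RAP; rewrite eb eg ed; split=> x y; rewrite !ffunE /=;
    rewrite ?(sM, star_inv) ?g0_fixed ?xg0 -!mulgA ?g0M //.
  by rewrite (mulgA (star y)) sqS -mulgA.
Qed.
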